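(* Let $\mathcal{X}\subseteq\mathbb{R}^n$ and let $g(x,y)$, $x\in\mathbb{R}^n$, $y\in\mathbb{R}^m$, be a smooth real-valued function. Let $\nu>0$ be any constant, let $a$ be chosen uniformly at random from $[-\nu,\nu]^m$, and set $$\widetilde g_a(x,y):=g(x,y)+a^\top y .$$ Then, with probability one over the choice of $a$, the function $\widetilde g_a(x,y)$ is Morse in $y$ for almost every $x\in\mathcal{X}$ (with respect to Lebesgue measure).
   Context: For a fixed $x$, a function $g(x,y)$ is called Morse in $y$ (at $x$) if every stationary point with respect to $y$ is non-degenerate: whenever $\nabla_y g(x,y)=0$, one has $\det(\nabla^2_{yy}g(x,y))\neq 0$. ''Smooth'' means $C^\infty$. $\mathcal{X}\subseteq\mathbb{R}^n$ is the feasible set of the variable $x$. *)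

(* Defs.v *)
From HB Require Import structures.
From mathcomp Require Import all_boot all_order all_algebra.
From mathcomp Require Import all_classical all_reals all_analysis.

Set Implicit Arguments.
Unset Strict Implicit.
Unset Printing Implicit Defensive.

Import Order.TTheory GRing.Theory Num.Theory.
Import numFieldNormedType.Exports.

Local Open Scope classical_set_scope.
Local Open Scope ring_scope.

Section differentiation.
Context {R : realType}.

(* f is C^(k+1) iff it is Frechet differentiable and, for every fixed v, the map
   z |-> 'd f z v = 'D_v f z is C^k: the domain being finite-dimensional, this is
   the same as 'd f being C^k. *)
Fixpoint class_C (k p q : nat) (f : 'rV[R]_p * 'rV[R]_q -> R) : Prop :=
  if k is k'.+1 then
    (forall z, differentiable f z) /\ (forall v, class_C k' ('D_v f))
  else continuous f.

Definition smooth (p q : nat) (f : 'rV[R]_p * 'rV[R]_q -> R) : Prop :=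
  forall k, class_C k f.

Definition basis_rV (m : nat) (i : 'I_m) : 'rV[R]_m := delta_mx 0 i.

Definition gradient (m : nat) (h : 'rV[R]_m -> R) (y : 'rV[R]_m) : 'rV[R]_m :=
  \row_i 'D_(basis_rV i) h y.

Definition hessian (m : nat) (h : 'rV[R]_m -> R) (y : 'rV[R]_m) : 'M[R]_m :=
  \matrix_(i, j) 'D_(basis_rV i) ('D_(basis_rV j) h) y.

Definition morse (m : nat) (h : 'rV[R]_m -> R) : Prop :=
  forall y, gradient h y = 0 -> \det (hessian h y) != 0.

End differentiation.

Definition measure_rV_display : measure_display -> measure_display.
Proof. exact. Qed.

Section measurable_rV.
Context {R : realType} (n : nat).

Let coord (i : 'I_n) (x : 'rV[R]_n) : R := x 0 i.

Let rV_set0 : g_sigma_preimage coord set0.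
Proof. exact: sigma_algebra0. Qed.

Let rV_setC A : g_sigma_preimage coord A -> g_sigma_preimage coord (~` A).
Proof. exact: sigma_algebraC. Qed.

Let rV_bigcup (F : (set 'rV[R]_n)^nat) :
  (forall i, g_sigma_preimage coord (F i)) ->
  g_sigma_preimage coord (\bigcup_i (F i)).
Proof. exact: sigma_algebra_bigcup. Qed.

(* The sigma-algebra generated by the coordinates, i.e. the Borel sets. *)
HB.instance Definition _ :=
  @isMeasurable.Build (measure_rV_display default_measure_display)
    'rV[R]_n (g_sigma_preimage coord) rV_set0 rV_setC rV_bigcup.

Lemma measurable_coord (i : 'I_n) :
  measurable_fun [set: 'rV[R]_n] (fun x : 'rV[R]_n => x 0 i).
Proof.
move=> _ Y mY; rewrite setTI; apply: sub_sigma_algebra => /=.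
rewrite -bigcup_seq/=; exists i => /=; first by rewrite mem_index_enum.
by exists Y => //; rewrite setTI.
Qed.

Lemma measurable_fun_rV d (T : measurableType d) (f : T -> 'rV[R]_n) :
  (forall i, measurable_fun [set: T] (fun t => f t 0 i)) ->
  measurable_fun [set: T] f.
Proof.
move=> mf _ Y mY.
suff : (image_set_system setT f measurable) Y by [].
apply: mY; split => [|A]; first exact/sigma_algebra_image/sigma_algebra_measurable.
rewrite -bigcup_seq => -[i _ [B mB <-]].
by rewrite /image_set_system/= setTI; exact: (mf i).
Qed.

Lemma measurable_box (A : 'I_n -> set R) : (forall i, measurable (A i)) ->
  measurable [set x : 'rV[R]_n | forall i, A i (x 0 i)].
Proof.
move=> mA.
rewrite (_ : mkset _ =
    \bigcap_(i in setT) ((fun x : 'rV[R]_n => x 0 i) @^-1` A i)).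
  apply: fin_bigcap_measurable => // i _.
  by rewrite -[X in measurable X]setTI; exact: measurable_coord.
by apply/seteqP; split => x /= Ax; [move=> i _|move=> i]; exact: Ax.
Qed.

End measurable_rV.

Definition row_cons {R : realType} {n : nat} (r : R) (v : 'rV[R]_n) :
  'rV[R]_n.+1 := row_mx (r%:M : 'rV[R]_1) v.

(* Lebesgue measure on the Borel sets of R^n, as the iterated product of the
   Lebesgue measure on R; see [lebesgue_rV_box]. *)
Fixpoint lebesgue_rV {R : realType} {n : nat} : set 'rV[R]_n -> \bar R :=
  match n with
  | 0 => dirac (0 : 'rV[R]_0)
  | n'.+1 => fun A : set 'rV[R]_n'.+1 =>
    (\int[lebesgue_measure]_r lebesgue_rV [set v : 'rV[R]_n' | A (row_cons r v)])%E
  end.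
Arguments lebesgue_rV : simpl never.

Section lebesgue_rV_theory.
Context {R : realType}.

Lemma row_cons0 n (r : R) (v : 'rV[R]_n) : row_cons r v 0 ord0 = r.
Proof.
have := row_mxEl (r%:M : 'rV[R]_1) v 0 ord0; rewrite [RHS]mxE mulr1n.
by rewrite (_ : lshift n ord0 = ord0); last exact/val_inj.
Qed.

Lemma row_consS n (r : R) (v : 'rV[R]_n) (i : 'I_n) :
  row_cons r v 0 (lift ord0 i) = v 0 i.
Proof.
rewrite -[RHS](row_mxEr (r%:M : 'rV[R]_1)).
by rewrite (_ : rshift 1%N i = lift ord0 i); last exact/val_inj.
Qed.

Lemma measurable_row_cons n :
  measurable_fun [set: R * 'rV[R]_n] (fun z => row_cons z.1 z.2).
Proof.
apply: measurable_fun_rV => i; case: (unliftP ord0 i) => [j|] ->.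
  rewrite (_ : (fun _ => _) = (fun x : 'rV[R]_n => x 0 j) \o snd).
    by apply: measurableT_comp => //; exact: measurable_coord.
  by apply/funext => z /=; rewrite row_consS.
rewrite (_ : (fun _ => _) = fst) //.
by apply/funext => z /=; rewrite row_cons0.
Qed.


Lemma lebesgue_rVS n : @lebesgue_rV R n.+1 =
  pushforward (lebesgue_measure \x @lebesgue_rV R n)%E
    (fun z : R * 'rV[R]_n => row_cons z.1 z.2).
Proof.
apply/funext => A; rewrite /pushforward /product_measure1.
apply: eq_integral => r _; congr lebesgue_rV.
by apply/seteqP; split => v; rewrite /xsection/= inE.
Qed.

Lemma row_consK n (x : 'rV[R]_n.+1) :
  row_cons (x 0 ord0) (\row_i x 0 (lift ord0 i)) = x.
Proof.
apply/rowP => i; case: (unliftP ord0 i) => [j|] ->.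
  by rewrite row_consS mxE.
by rewrite row_cons0.
Qed.

Let lebesgue_rV_exists n :
  exists mu : {sigma_finite_measure set 'rV[R]_n -> \bar R},
    @lebesgue_rV R n = mu.
Proof.
elim: n => [|n [mu IHn]]; first by exists (dirac (0 : 'rV[R]_0)).
rewrite lebesgue_rVS IHn.
have mc := @measurable_row_cons n.
pose pm : {measure set 'rV[R]_n.+1 -> \bar R} :=
  pushforward (lebesgue_measure \x mu)%E
    (fun z : R * 'rV[R]_n => row_cons z.1 z.2).
pose m := pm mc.
have sm : sigma_finite setT m.
  pose l : {sigma_finite_measure set (measurableTypeR R) -> \bar R} :=
    lebesgue_measure.
  have /sigma_finiteP[F [TF ndF mF]] := sigma_finiteT l.
  have /sigma_finiteP[G [TG ndG mG]] := sigma_finiteT mu.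
  exists (fun k => [set x : 'rV[R]_n.+1 |
      F k (x 0 ord0) /\ G k (\row_i x 0 (lift ord0 i))]) => [|k].
    apply/seteqP; split => // x _.
    have : [set: measurableTypeR R] (x 0 ord0) by [].
    rewrite TF => -[i _ Fi].
    have : [set: 'rV[R]_n] (\row_i x 0 (lift ord0 i)) by [].
    rewrite TG => -[j _ Gj].
    exists (maxn i j) => //; split.
      by move: Fi; exact/subsetPset/ndF/leq_maxl.
    by move: Gj; exact/subsetPset/ndG/leq_maxr.
  have [mFk Fk] := mF k; have [mGk Gk] := mG k; split.
    apply: measurableI.
      rewrite -[X in measurable X]setTI.
      exact: (measurable_coord ord0 measurableT mFk).
    have mtl : measurable_fun setT
        (fun x : 'rV[R]_n.+1 => \row_i x 0 (lift ord0 i)).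
      apply: measurable_fun_rV => i.
      rewrite (_ : (fun _ => _) = fun x : 'rV[R]_n.+1 => x 0 (lift ord0 i)).
        exact: measurable_coord.
      by apply/funext => x; rewrite mxE.
    by rewrite -[X in measurable X]setTI; exact: mtl.
  rewrite /m/= /pushforward/= (_ : _ @^-1` _ = F k `*` G k).
    by rewrite product_measure1E// lte_mul_pinfty// ge0_fin_numE.
  apply/seteqP; split => -[r v] /=; rewrite row_cons0;
    by rewrite (_ : \row_i _ = v)//; apply/rowP => i; rewrite mxE row_consS.
pose s := Measure_isSigmaFinite.Build _ _ _ m sm.
pose m' : {sigma_finite_measure set 'rV[R]_n.+1 -> \bar R} :=
  HB.pack (m : set _ -> \bar R) (Measure.class m) s.
by exists m'.
Qed.

Let lebesgue_rV0 n : @lebesgue_rV R n set0 = 0%E.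
Proof. by have [mu ->] := lebesgue_rV_exists n; exact: measure0. Qed.

Let lebesgue_rV_ge0 n A : (0 <= @lebesgue_rV R n A)%E.
Proof. by have [mu ->] := lebesgue_rV_exists n; exact: measure_ge0. Qed.

Let lebesgue_rV_sigma_additive n : semi_sigma_additive (@lebesgue_rV R n).
Proof.
by have [mu ->] := lebesgue_rV_exists n; exact: measure_semi_sigma_additive.
Qed.

HB.instance Definition _ n := isMeasure.Build _ _ _ (@lebesgue_rV R n)
  (lebesgue_rV0 n) (@lebesgue_rV_ge0 n) (@lebesgue_rV_sigma_additive n).

Let lebesgue_rV_sigma_finite n : sigma_finite setT (@lebesgue_rV R n).
Proof. by have [mu ->] := lebesgue_rV_exists n; exact: sigma_finiteT. Qed.

HB.instance Definition _ n :=
  Measure_isSigmaFinite.Build _ _ _ (@lebesgue_rV R n)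
    (@lebesgue_rV_sigma_finite n).

Lemma lebesgue_rV_box n (A : 'I_n -> set R) : (forall i, measurable (A i)) ->
  lebesgue_rV [set x : 'rV[R]_n | forall i, A i (x 0 i)] =
  (\prod_i lebesgue_measure (A i))%E.
Proof.
elim: n A => [|n IHn] A mA.
  by rewrite big_ord0 /lebesgue_rV diracE mem_set// => -[].
have mB : measurable [set x : 'rV[R]_n | forall i, A (lift ord0 i) (x 0 i)].
  exact: (measurable_box (A := fun i => A (lift ord0 i))).
rewrite big_ord_recl -IHn// lebesgue_rVS.
apply: etrans (product_measure1E lebesgue_measure (@lebesgue_rV R n)
  (mA ord0) mB).
congr product_measure1; apply/seteqP; split => -[r v] /=.
  move=> rvA; split => [|i]; first by rewrite -(row_cons0 r v).
  by rewrite -(row_consS r v).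
move=> [Ar Av] i; case: (unliftP ord0 i) => [j|] ->.
  by rewrite row_consS.
by rewrite row_cons0.
Qed.

End lebesgue_rV_theory.

Section uniform.
Context {R : realType} (m : nat) (nu : R).

Definition cube : set 'rV[R]_m := [set a | forall i, a 0 i \in `[- nu, nu]].

Lemma measurable_cube : measurable cube.
Proof.
by apply: (@measurable_box _ _ (fun=> `[- nu, nu]%classic)) => i.
Qed.

(* Normalized restriction of the Lebesgue measure; the default measure [dirac 0]
   of [mnormalize] plays no role when [nu > 0], see [uniform_cubeE]. *)
Definition uniform_cube : probability 'rV[R]_m R :=
  mnormalize (mrestr lebesgue_rV measurable_cube) (dirac (0 : 'rV[R]_m)).

Lemma lebesgue_rV_cube : 0 < nu ->
  lebesgue_rV cube = ((2 * nu) ^+ m)%:E.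
Proof.
move=> nu0.
rewrite (@lebesgue_rV_box _ _ (fun=> `[- nu, nu]%classic))//.
under eq_bigr do rewrite lebesgue_measure_itv/= lte_fin gtrN// -EFinD opprK.
by rewrite prodEFin big_const_ord iter_mulr_1 mulr_natl mulr2n.
Qed.

Lemma uniform_cubeE (A : set 'rV[R]_m) : 0 < nu ->
  uniform_cube A = (lebesgue_rV (A `&` cube) * ((2 * nu) ^- m)%:E)%E.
Proof.
move=> nu0; have c0 : 0 < (2 * nu) ^+ m by rewrite exprn_gt0// mulr_gt0.
rewrite /uniform_cube/= /mnormalize/= /mrestr.
rewrite (_ : [set: _] `&` cube = cube) ?setTI// lebesgue_rV_cube//=.
by rewrite orbF eqe gt_eqF.
Qed.

End uniform.

(* Main.v *)
Require Import Defs.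
From HB Require Import structures.
From mathcomp Require Import all_boot all_order all_algebra.
From mathcomp Require Import all_classical all_reals all_analysis.
From mathcomp Require Import measurable_realfun ring lra.
Import Order.TTheory GRing.Theory Num.Theory.
Import numFieldNormedType.Exports.
Local Open Scope classical_set_scope.
Local Open Scope ring_scope.

(** Adding the linear form a^T y shifts the y-gradient of g by a and leaves the
    y-Hessian unchanged. Hence, for a fixed x, the tilted function fails to be
    Morse exactly when a = - grad_y g(x, y) for some y at which the Hessian is
    singular, that is, when a is a critical value of the map
    f_x(y) = - grad_y g(x, y) from R^m to itself. By Sard's theorem in equal
    dimensions, such a form a null set for every x. The theorem exchanges the
    quantifiers: if the set of all bad pairs (a, x) is measurable, Tonelli's
    theorem makes almost every section at fixed a null as well
    ([product_null_ae]).

    Measurability: with y confined to a compact set K, the bad pairs are the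
    projection along K of a closed set, hence closed
    ([closed_compact_projection]), and closed sets are Borel for the product
    sigma-algebra ([closed_prod_rV_measurable]). The bad set is a countable
    union of these over an exhaustion of R^m by cubes.

    Sard ([sard_compact]): at a critical point y the derivative takes its values
    in a hyperplane, so the image of a small ball of radius r around y lies in a
    slab whose width is o(r) and whose other dimensions are O(r); its volume is
    o(r^m) ([critical_ball_image]). Only differentiability at the centre of the
    ball is used, so the estimate holds on a neighbourhood whose size depends on
    y, without any uniformity. A Vitali selection ([vitali_selection]) absorbs
    this: from a finite cover of the compact critical set by such balls one keeps
    balls whose total volume is bounded and whose threefold enlargements still
    cover. The images of the enlarged balls then have arbitrarily small total
    measure. *)

Set Implicit Arguments.
Unset Strict Implicit.
Unset Printing Implicit Defensive.

(** * Product measures and sections *)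

Section product_bound.
Context d1 d2 (T1 : measurableType d1) (T2 : measurableType d2) (R : realType).
Variables (m1 : {sigma_finite_measure set T1 -> \bar R}).
Variables (m2 : {sigma_finite_measure set T2 -> \bar R}).
Variables (A : set (T1 * T2)) (mA : measurable A) (k : \bar R).
Hypothesis k0 : (0 <= k)%E.

Lemma product_measure_le_xsection (B : set T1) : measurable B ->
  A `<=` fst @^-1` B -> (forall x, B x -> (m2 (xsection A x) <= k)%E) ->
  ((m1 \x m2) A <= m1 B * k)%E.
Proof.
move=> mB AB Ak.
apply: (@le_trans _ _ (\int[m1]_x (k * (\1_B x)%:E))%E); last first.
  rewrite ge0_integralZl//; last first.
    by apply/measurable_EFinP; exact: measurable_indic.
  by rewrite integral_indic// setIT muleC.
apply: ge0_le_integral => //.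
- exact: measurable_fun_xsection.
- apply: emeasurable_funM => //.
  by apply/measurable_EFinP; exact: measurable_indic.
- move=> x _ /=; rewrite indicE; have [|xB] := boolP (x \in B).
    by rewrite mule1 inE; exact: Ak.
  rewrite mule0 (_ : xsection A x = set0) ?measure0//.
  apply/seteqP; split => // y; rewrite /xsection/= inE => /AB/=.
  by move/mem_set; rewrite (negbTE xB).
Qed.

Lemma product_measure_swap : ((m1 \x m2) A = (m1 \x^ m2) A)%E.
Proof.
by apply: product_measure_unique => //= ? ? ? ?; rewrite product_measure2E.
Qed.

Lemma product_measure_le_ysection (B : set T2) : measurable B ->
  A `<=` snd @^-1` B -> (forall y, B y -> (m1 (ysection A y) <= k)%E) ->
  ((m1 \x m2) A <= m2 B * k)%E.
Proof.
move=> mB AB Ak; rewrite product_measure_swap.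
apply: (@le_trans _ _ (\int[m2]_x (k * (\1_B x)%:E))%E); last first.
  rewrite ge0_integralZl//; last first.
    by apply/measurable_EFinP; exact: measurable_indic.
  by rewrite integral_indic// setIT muleC.
apply: ge0_le_integral => //.
- exact: measurable_fun_ysection.
- apply: emeasurable_funM => //.
  by apply/measurable_EFinP; exact: measurable_indic.
- move=> y _ /=; rewrite indicE; have [|yB] := boolP (y \in B).
    by rewrite mule1 inE; exact: Ak.
  rewrite mule0 (_ : ysection A y = set0) ?measure0//.
  apply/seteqP; split => // x; rewrite /ysection/= inE => /AB/=.
  by move/mem_set; rewrite (negbTE yB).
Qed.

(** By Tonelli both iterated integrals of the section measures vanish, and a
    nonnegative function of integral 0 is 0 almost everywhere. This exchanges a
    quantifier over the first coordinate with one over the second. *)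
Lemma product_null_ae : (forall y, m1 (ysection A y) = 0%E) ->
  {ae m1, forall x, m2 (xsection A x) = 0%E}.
Proof.
move=> A0.
have iA : (\int[m1]_x `|m2 (xsection A x)| = 0)%E.
  have -> : (\int[m1]_x `|m2 (xsection A x)| = (m1 \x m2) A)%E.
    by apply: eq_integral => x _; rewrite gee0_abs.
  rewrite product_measure_swap /product_measure2.
  under eq_integral do rewrite /= A0.
  by rewrite integral0.
have /(ae_eq_integral_abs m1 measurableT) := iA.
by move=> /(_ (measurable_fun_xsection m2 mA)); apply: filterS => x; exact.
Qed.
End product_bound.

(** * Volume of a slab *)

(** The points of the cube of half-width b around p that are within t of the
    affine hyperplane on which the functional u, measured from p, equals c. The
    offset c is what fixing a coordinate produces in the induction on the
    dimension. *)
Definition slab {R : realType} {n : nat} (p u : 'rV[R]_n) (c b t : R) :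
  set 'rV[R]_n :=
  [set w | (forall j, `|w 0 j - p 0 j| <= b) /\
           `|\sum_j u 0 j * (w 0 j - p 0 j) - c| <= t].

Section slab.
Context {R : realType}.

Lemma measurable_slab n (p u : 'rV[R]_n) c b t : measurable (slab p u c b t).
Proof.
have mw (j : 'I_n) : measurable_fun setT (fun w : 'rV[R]_n => w 0 j - p 0 j).
  by apply: measurable_funB => //; exact: measurable_coord.
rewrite (_ : slab _ _ _ _ _ =
  (\bigcap_(j in setT)
     (fun w : 'rV[R]_n => w 0 j - p 0 j) @^-1` [set r | `|r| <= b]) `&`
  (fun w : 'rV[R]_n => \sum_j u 0 j * (w 0 j - p 0 j) - c) @^-1`
     [set r | `|r| <= t]).
  have mle (s : R) : measurable [set r : R | `|r| <= s].
    rewrite (_ : mkset _ = `[- s, s]%classic); first exact: measurable_itv.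
    by apply/seteqP; split => r /=; rewrite in_itv/= ler_norml.
  apply: measurableI.
    apply: fin_bigcap_measurable => // j _.
    by rewrite -[X in measurable X]setTI; exact: mw.
  rewrite -[X in measurable X]setTI; have : measurable_fun [set: 'rV[R]_n]
     (fun w : 'rV[R]_n => \sum_j u 0 j * (w 0 j - p 0 j) - c).
    apply: measurable_funB => //; apply: measurable_sum => j.
    by apply: measurable_funM.
  by apply.
by apply/seteqP; split => w /= [w1 w2]; split => // j; [move=> _|]; exact: w1.
Qed.

Lemma measurable_cball (c t : R) :
  measurable ([set r : R | `|r - c| <= t] : set (measurableTypeR R)).
Proof.
rewrite (_ : mkset _ = `[c - t, c + t]%classic); first exact: measurable_itv.
by apply/seteqP; split => r /=; rewrite in_itv/= ler_distl.
Qed.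

Lemma lebesgue_measure_cball (c t : R) : 0 <= t ->
  lebesgue_measure ([set r : R | `|r - c| <= t] : set (measurableTypeR R)) =
  (2 * t)%:E.
Proof.
move=> t0; rewrite (_ : mkset _ = `[c - t, c + t]%classic); last first.
  by apply/seteqP; split => r /=; rewrite in_itv/= ler_distl.
rewrite lebesgue_measure_itv/= lte_fin; case: ltP => [_|].
  by rewrite -EFinB; congr EFin; lra.
by move=> h; congr EFin; lra.
Qed.

Let leb : {sigma_finite_measure set (measurableTypeR R) -> \bar R} :=
  lebesgue_measure.

Lemma measurable_slab_cons n (p u : 'rV[R]_n.+1) c b t :
  measurable ((fun z : R * 'rV[R]_n => row_cons z.1 z.2) @^-1` slab p u c b t).
Proof.
rewrite -[X in measurable X]setTI.
by apply: measurable_row_cons => //; exact: measurable_slab.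
Qed.

Lemma lebesgue_rV_cbox n (p : 'rV[R]_n) b : 0 <= b ->
  lebesgue_rV [set w : 'rV[R]_n | forall j, `|w 0 j - p 0 j| <= b] =
  ((2 * b) ^+ n)%:E.
Proof.
move=> b0.
rewrite (@lebesgue_rV_box _ _ (fun j => [set r | `|r - p 0 j| <= b])).
  under eq_bigr do rewrite lebesgue_measure_cball//.
  by rewrite prodEFin big_const_ord iter_mulr_1.
move=> j; exact: measurable_cball.
Qed.

(** With the distinguished first coordinate integrated innermost, each section is
    contained in an interval of half-width t. *)
Lemma lebesgue_rV_slab_ord0 n (p u : 'rV[R]_n.+1) c b t :
  0 <= b -> 0 <= t -> u 0 ord0 = 1 ->
  (lebesgue_rV (slab p u c b t) <= ((2 * b) ^+ n * (2 * t))%:E)%E.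
Proof.
move=> b0 t0 u0; rewrite lebesgue_rVS /pushforward.
pose p' : 'rV[R]_n := \row_j p 0 (lift ord0 j).
rewrite EFinM -(lebesgue_rV_cbox p' b0).
apply: (@product_measure_le_ysection _ _ _ _ _ leb (@lebesgue_rV R n) _
  (measurable_slab_cons p u c b t) (2 * t)%:E _
  [set w : 'rV[R]_n | forall j : 'I_n, `|w 0 j - p' 0 j| <= b]).
- by rewrite lee_fin mulr_ge0.
- apply: (@measurable_box _ _ (fun j => [set r | `|r - p' 0 j| <= b])) => j.
  exact: measurable_cball.
- move=> [r v] [/= + _] j => /(_ (lift ord0 j)).
  by rewrite row_consS /p' mxE.
- move=> v _.
  pose d := p 0 ord0 + c -
    \sum_j u 0 (lift ord0 j) * (v 0 j - p 0 (lift ord0 j)).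
  rewrite -(lebesgue_measure_cball d t0); apply: le_measure.
  + rewrite inE; apply: measurable_ysection; exact: measurable_slab_cons.
  + rewrite inE; exact: measurable_cball.
  + move=> r; rewrite /ysection/= inE => -[/= _].
    rewrite big_ord_recl row_cons0 u0 mul1r.
    under eq_bigr do rewrite row_consS.
    by congr (`|_| <= t); rewrite /d; lra.
Qed.

(** The normalisation u i = 1 confines coordinate i to an interval of length 2t
    once the others are fixed. Coordinates are integrated out one at a time from
    the first: before i is reached each contributes a factor 2b and shifts the
    offset c; then [lebesgue_rV_slab_ord0] applies. *)
Lemma lebesgue_rV_slab n (i : 'I_n.+1) (p u : 'rV[R]_n.+1) c b t :
  0 <= b -> 0 <= t -> u 0 i = 1 ->
  (lebesgue_rV (slab p u c b t) <= ((2 * b) ^+ n * (2 * t))%:E)%E.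
Proof.
move=> b0 t0; elim: n => [|n IHn] in i p u c *.
  by rewrite (ord1 i); exact: lebesgue_rV_slab_ord0.
case: (unliftP ord0 i) => [j ->|->] ui; last exact: lebesgue_rV_slab_ord0.
rewrite lebesgue_rVS /pushforward exprS -mulrA EFinM.
rewrite -(lebesgue_measure_cball (p 0 ord0) b0).
apply: (@product_measure_le_xsection _ _ _ _ _ leb (@lebesgue_rV R n.+1) _
  (measurable_slab_cons p u c b t) ((2 * b) ^+ n * (2 * t))%:E _
  [set r : R | `|r - p 0 ord0| <= b]).
- by rewrite lee_fin !mulr_ge0// exprn_ge0// mulr_ge0.
- exact: measurable_cball.
- by move=> [r v] [/= + _] => /(_ ord0); rewrite row_cons0.
- move=> r _.
  pose p' : 'rV[R]_n.+1 := \row_k p 0 (lift ord0 k).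
  pose u' : 'rV[R]_n.+1 := \row_k u 0 (lift ord0 k).
  have u'j : u' 0 j = 1 by rewrite mxE.
  apply: le_trans (IHn j p' u' (c - u 0 ord0 * (r - p 0 ord0)) u'j).
  apply: le_measure.
  + rewrite inE; apply: measurable_xsection; exact: measurable_slab_cons.
  + by rewrite inE; exact: measurable_slab.
  + move=> v; rewrite /xsection/= inE => -[/= rv].
    rewrite big_ord_recl row_cons0 => h; split => [k|].
      by have := rv (lift ord0 k); rewrite row_consS mxE.
    move: h; congr (`|_| <= t).
    under [in RHS]eq_bigr do rewrite !mxE.
    under [in LHS]eq_bigr do rewrite row_consS.
    by lra.
Qed.
End slab.

(** * Vitali selection of finitely many balls *)

Section vitali.
Context {R : realType} {n : nat}.
Implicit Types (s D : seq ('rV[R]_n * R)).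

Lemma rV_ball_box (x : 'rV[R]_n) r : 0 < r ->
  ball x r = [set y | forall j, ball (x 0 j) r (y 0 j)].
Proof.
move=> r0; apply/seteqP; split => [y [_ yx] j|y yx]; first exact: yx.
by split => // i j; rewrite (ord1 i); exact: yx.
Qed.

Lemma measurable_rV_ball (x : 'rV[R]_n) r : measurable (ball x r).
Proof.
have [r0|r0] := ltP 0 r; last first.
  rewrite (_ : ball x r = set0)//; apply/seteqP; split => // y [].
  by rewrite ltNge r0.
rewrite rV_ball_box//.
apply: (@measurable_box _ _ (fun j => ball (x 0 j) r)) => j.
exact: measurable_ball.
Qed.

Lemma lebesgue_rV_ball (x : 'rV[R]_n) r : 0 < r ->
  lebesgue_rV (ball x r) = ((2 * r) ^+ n)%:E.
Proof.
move=> r0; rewrite rV_ball_box//.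
rewrite (@lebesgue_rV_box _ _ (fun j => ball (x 0 j) r)).
  under eq_bigr do rewrite lebesgue_measure_ball ?ltW//.
  by rewrite prodEFin big_const_ord iter_mulr_1 mulr_natl.
by move=> j; exact: measurable_ball.
Qed.

Lemma ball_sub_triple (x z : 'rV[R]_n) r t : r <= t ->
  ball x r `&` ball z t !=set0 -> ball x r `<=` ball z (3 * t).
Proof.
move=> rt [w [xw zw]] v xv.
rewrite (_ : 3 * t = t + (t + t)); last by lra.
apply: (ball_triangle zw); apply: ball_triangle (le_ball rt xv).
exact/ball_sym/(le_ball rt).
Qed.

Lemma seq_max_radius s : s != [::] ->
  exists2 b, b \in s & forall c, c \in s -> c.2 <= b.2.
Proof.
elim: s => // a s IH _; have [->|/IH[b bs bmax]] := eqVneq s [::].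
  by exists a; rewrite ?mem_seq1// => c; rewrite mem_seq1 => /eqP ->.
have [ab|ba] := leP a.2 b.2.
  exists b; first by rewrite inE bs orbT.
  by move=> c; rewrite inE => /predU1P[->//|/bmax].
exists a; first by rewrite inE eqxx.
move=> c; rewrite inE => /predU1P[->//|/bmax cb].
exact: le_trans cb (ltW ba).
Qed.

(** Greedy choice: keep a ball b of largest radius; every ball meeting b lies in
    its threefold enlargement, and the others are handled by induction inside
    U minus b. Shrinking the ambient set encodes the disjointness of the kept
    balls and yields the bound on their total measure directly. *)
Lemma vitali_selection s (U : set 'rV[R]_n) : measurable U ->
  (forall b, b \in s -> 0 < b.2 /\ ball b.1 b.2 `<=` U) ->
  exists D, [/\ {subset D <= s},
    forall b, b \in s ->
      exists2 d, d \in D & ball b.1 b.2 `<=` ball d.1 (3 * d.2) &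
    (\sum_(d <- D) lebesgue_rV (ball d.1 d.2) <= lebesgue_rV U)%E].
Proof.
have [k] := ubnP (size s); elim: k => // k IH in s U * => sk mU sU.
have [->|s0] := eqVneq s [::].
  by exists [::]; split => //; rewrite big_nil.
have [b bs bmax] := seq_max_radius s0; have [b0 bU] := sU b bs.
pose s' := [seq c <- s | `[< ball c.1 c.2 `&` ball b.1 b.2 = set0 >]].
have s's c : c \in s' -> c \in s /\ ball c.1 c.2 `&` ball b.1 b.2 = set0.
  by rewrite mem_filter => /andP[/asboolP].
have s'k : (size s' < k)%N.
  rewrite -ltnS; apply: leq_trans sk; rewrite ltnS size_filter.
  rewrite -(count_predC (fun c => `[< ball c.1 c.2 `&` ball b.1 b.2 = set0 >])).
  rewrite -[X in (X < _)%N]addn0 ltn_add2l -has_count.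
  apply/hasP; exists b => //=.
  apply/negP => /asboolP; rewrite setIid => bb.
  have : ball b.1 b.2 b.1 by exact: ballxx.
  by rewrite bb.
have mb := measurable_rV_ball b.1 b.2.
have [|c /s's[cs cb]|D [Ds' Dcov Dsum]] := IH s' (U `\` ball b.1 b.2) s'k.
- exact: measurableD.
- have [c0 cU] := sU c cs; split => // x cx; split; first exact: cU.
  by move=> bx; rewrite -[False]/(set0 x) -cb.
exists (b :: D); split.
- by move=> c; rewrite inE => /predU1P[->//|/Ds'/s's[]].
- move=> c cs.
  have [cb|/eqP/set0P cb] := pselect (ball c.1 c.2 `&` ball b.1 b.2 = set0).
    have [|d dD cd] := Dcov c.
      by rewrite mem_filter cs andbT; exact/asboolP.
    by exists d => //; rewrite inE dD orbT.
  exists b; first by rewrite inE eqxx.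
  exact: ball_sub_triple (bmax _ cs) cb.
- rewrite big_cons; apply: (@le_trans _ _
    (lebesgue_rV (ball b.1 b.2) + lebesgue_rV (U `\` ball b.1 b.2))%E).
    exact: leeD2l.
  rewrite -measureU//; last 2 first.
  + exact: measurableD.
  + by rewrite setDE setICA setICr setI0.
  by rewrite setDUK.
Qed.
End vitali.

(** * Null sets and finite unions *)

Section negligible.
Context d (T : measurableType d) (R : realType).
Variable mu : {measure set T -> \bar R}.

(** The intersection of measurable covers of measure at most 1/(k+1) is a
    measurable null set containing A. *)
Lemma negligible_small_cover (A : set T) :
  (forall e : R, 0 < e ->
    exists S, [/\ measurable S, A `<=` S & (mu S <= e%:E)%E]) ->
  mu.-negligible A.
Proof.
move=> Acov.
have /choice[S SP] : forall k : nat, exists S,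
    [/\ measurable S, A `<=` S & (mu S <= (k.+1%:R^-1)%:E)%E].
  by move=> k; apply: Acov; rewrite invr_gt0.
have mS : measurable (\bigcap_k S k).
  by apply: bigcap_measurable => // k _; case: (SP k).
exists (\bigcap_k S k); split => //; last first.
  by move=> x Ax k _; case: (SP k) => _ /(_ x Ax).
apply/eqP; rewrite eq_le measure_ge0 andbT; apply/lee_addgt0Pr => e e0.
rewrite add0e.
have [mSk _ Sk] := SP (Num.truncn e^-1).
apply: (@le_trans _ _ (mu (S (Num.truncn e^-1)))).
  by apply: le_measure; rewrite ?inE//; exact: bigcap_inf.
apply: (le_trans Sk); rewrite lee_fin.
rewrite -[leRHS]invrK lef_pV2 ?posrE ?invr_gt0//.
by apply: ltW; exact: truncnS_gt.
Qed.

Lemma measure_big_setU_le (I : Type) (s : seq I) (F : I -> set T) :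
  (forall i, measurable (F i)) ->
  (mu (\big[setU/set0]_(i <- s) F i) <= \sum_(i <- s) mu (F i))%E.
Proof.
move=> mF; elim: s => [|i s IH]; first by rewrite !big_nil measure0.
rewrite !big_cons; apply: le_trans (measureU2 _ _ _) _ => //.
  exact: bigsetU_measurable.
exact: leeD2l.
Qed.
End negligible.

(** * Sard's theorem in equal dimensions *)

Section sard.
Context {R : realType}.

Lemma ler_coord_norm n (h : 'rV[R]_n) j : `|h 0 j| <= `|h|.
Proof.
rewrite [leRHS]/Num.norm/= mx_normrE.
by apply/bigmax_geP; right => /=; exists (0, j).
Qed.

(** A singular derivative has its image in the kernel of a nonzero functional u;
    scaling u to have some coordinate equal to 1 is the form that the slab bound
    needs. *)
Lemma singular_functional n (A : 'M[R]_n) : \det A = 0 ->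
  exists i, exists u : 'rV[R]_n,
    u 0 i = 1 /\ forall h : 'rV[R]_n, \sum_j u 0 j * (h *m A) 0 j = 0.
Proof.
rewrite -det_tr => /eqP/det0P[v v0 vA].
have [i vi0] : exists i, v 0 i != 0.
  apply/existsP; apply: contra_neqT v0; rewrite negb_exists => /forallP v0.
  by apply/rowP => i; rewrite mxE; exact/eqP/negbNE/v0.
exists i, ((v 0 i)^-1 *: v); split; first by rewrite mxE mulVf.
move=> h; have : (h *m A *m ((v 0 i)^-1 *: v)^T) 0 0 = 0.
  rewrite -mulmxA linearZ/= -scalemxAr -[A]trmxK -trmx_mul vA.
  by rewrite trmx0 scaler0 mulmx0 mxE.
rewrite mxE => {2}<-; apply: eq_bigr => j _.
by rewrite mulrC; congr (_ * _); rewrite !mxE.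
Qed.

Lemma ler_mulmx_coord n (h : 'rV[R]_n) (A : 'M[R]_n) j :
  `|(h *m A) 0 j| <= `|h| * \sum_k \sum_l `|A k l|.
Proof.
rewrite mxE mulr_sumr; apply: le_trans (ler_norm_sum _ _ _) _.
apply: ler_sum => k _; rewrite normrM; apply: ler_pM => //.
  exact: ler_coord_norm.
by rewrite (bigD1 j)//= lerDl sumr_ge0.
Qed.

(** For r small the derivative approximates f on the ball up to e r. Since a
    functional u annihilates the derivative, the image lies within U e r of a
    hyperplane, where U is the l1-norm of u, and inside a cube of half-width M r.
    The slab bound gives measure at most M^(n-1) U e (2r)^n, and e is as small as
    needed. *)
Lemma critical_ball_image n (f : 'rV[R]_n -> 'rV[R]_n) (y : 'rV[R]_n) :
  differentiable f y -> \det (jacobian f y) = 0 -> forall eta, 0 < eta ->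
  exists2 r0, 0 < r0 & forall r, 0 < r < r0 -> exists S, [/\ measurable S,
    f @` ball y r `<=` S & (lebesgue_rV S <= (eta * (2 * r) ^+ n)%:E)%E].
Proof.
case: n f y => [|n] f y df; first by rewrite det_mx00 => /eqP; rewrite oner_eq0.
move=> /singular_functional[i [u [ui uJ]]] eta eta0.
pose M := 1 + \sum_k \sum_l `|jacobian f y k l|.
pose U := \sum_j `|u 0 j|.
have M1 : 1 <= M by rewrite lerDl sumr_ge0// => k _; exact: sumr_ge0.
have M0 : 0 < M by exact: lt_le_trans M1.
have U0 : 0 < U.
  apply: (@lt_le_trans _ _ 1) => //.
  by rewrite /U (bigD1 i)//= ui normr1 lerDl sumr_ge0.
(* e <= 1 keeps the error within the cube, the other bound makes M ^+ n * U * e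
   at most eta. *)
pose e := Num.min 1 (eta / (M ^+ n * U)).
have e0 : 0 < e by rewrite lt_min ltr01 divr_gt0// mulr_gt0// exprn_gt0.
have eb : M ^+ n * U * e <= eta.
  rewrite mulrC -ler_pdivlMr ?mulr_gt0 ?exprn_gt0//.
  by rewrite ge_min lexx orbT.
have /eqaddoP/(_ e e0) := diff_locally df.
move=> /nbhs_ballP[r0/= r00 fr0]; exists r0 => // r /andP[r_gt0 rr0].
exists (slab (f y) u 0 (M * r) (U * e * r)); split.
- exact: measurable_slab.
- move=> _ [z yz <-]; pose h := z - y.
  have hr : `|h| < r.
    by move: yz; rewrite -ball_normE/= /h distrC.
  have /= := fr0 h; rewrite -ball_normE/= sub0r normrN.
  move=> /(_ (lt_trans hr rr0)) eh; pose E := f z - f y - h *m jacobian f y.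
  have {}eh : `|E| <= e * r.
    apply: (@le_trans _ _ (e * `|h|)); last by rewrite ler_pM2l// ltW.
    rewrite /E /jacobian mul_rV_lin1/= -[in f z](subrK y z) -/h.
    by move: eh; rewrite opprD addrA.
  have fzE j : f z 0 j - f y 0 j = (h *m jacobian f y) 0 j + E 0 j.
    by rewrite /E !mxE; lra.
  split => [j|].
    rewrite fzE (le_trans (ler_normD _ _))// /M mulrDl mul1r addrC.
    apply: lerD.
      apply: (le_trans (ler_coord_norm _ _)); apply: (le_trans eh).
      by apply: ler_piMl; [exact: ltW|rewrite /e ge_min lexx].
    apply: (le_trans (ler_mulmx_coord _ _ _)); rewrite mulrC.
    apply: ler_wpM2l; last exact: ltW.
    by apply: sumr_ge0 => k _; exact: sumr_ge0.
  under eq_bigr do rewrite fzE mulrDr.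
  rewrite big_split/= uJ add0r subr0 (le_trans (ler_norm_sum _ _ _))//.
  rewrite -mulrA /U mulr_suml; apply: ler_sum => j _.
  by rewrite normrM ler_wpM2l// (le_trans (ler_coord_norm _ _)).
- apply: (le_trans (lebesgue_rV_slab _ _ _ _ ui)).
  + by rewrite mulr_ge0// ltW.
  + by rewrite !mulr_ge0// ltW.
  rewrite lee_fin.
  have -> : (2 * (M * r)) ^+ n * (2 * (U * e * r)) =
      (M ^+ n * U * e) * (2 * r) ^+ n.+1.
    by rewrite !exprMn !exprS; ring.
  by apply: ler_wpM2r => //; rewrite exprn_ge0// mulr_ge0// ltW.
Qed.
End sard.

Section sard.
Context {R : realType} {n : nat}.
Variables (f : 'rV[R]_n -> 'rV[R]_n) (Z : set 'rV[R]_n).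

(** The covering balls have radius at most 1 and centres in Z, so the balls kept
    by the Vitali selection fit in a fixed ball, of measure C. The images of their
    threefold enlargements have total measure at most eta 3^n C, whence the
    choice of eta. *)
Lemma sard_compact : compact Z ->
  (forall y, Z y -> differentiable f y /\ \det (jacobian f y) = 0) ->
  (@lebesgue_rV R n).-negligible (f @` Z).
Proof.
move=> cZ critZ.
have [M M0 ZM] : exists2 M : R, 0 < M & Z `<=` ball 0 M.
  have [M [_ /(_ (`|M| + 1))ZM]] := compact_bounded cZ.
  exists (`|M| + 2) => [|y /ZM]; first by rewrite ltr_wpDl.
  rewrite -ball_normE/= sub0r normrN => yM; apply: (le_lt_trans (yM _)).
    by rewrite ltr_pwDr// ler_norm.
  by rewrite ltrD2l ltr1n.
pose C : R := (2 * (M + 1)) ^+ n.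
have C0 : 0 < C by rewrite exprn_gt0// mulr_gt0// addr_gt0.
apply: negligible_small_cover => e e0.
pose eta := e / (3 ^+ n * C).
have eta0 : 0 < eta by rewrite divr_gt0// mulr_gt0// exprn_gt0.
(* To y in Z are attached a radius rS.1 and a measurable set rS.2 containing the
   image of the threefold ball; elsewhere the values are arbitrary. *)
have /choice[rS rSP] : forall y, exists rS : R * set 'rV[R]_n,
    measurable rS.2 /\ (Z y -> [/\ 0 < rS.1 <= 1,
      f @` ball y (3 * rS.1) `<=` rS.2 &
      (lebesgue_rV rS.2 <= (eta * (2 * (3 * rS.1)) ^+ n)%:E)%E]).
  move=> y; have [Zy|nZy] := pselect (Z y); last first.
    by exists (0, set0); split => [|/nZy]; [exact: measurable0|].
  have [dfy Jy] := critZ y Zy.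
  have [r0 r00 fr] := critical_ball_image dfy Jy eta0.
  (* r0 / 6 makes the threefold radius strictly less than r0. *)
  pose r := Num.min 1 (r0 / 6).
  have r_gt0 : 0 < r by rewrite lt_min ltr01 divr_gt0.
  have rr0 : r <= r0 / 6 by rewrite ge_min lexx orbT.
  have r1 : r <= 1 by rewrite ge_min lexx.
  clearbody r.
  have [|S [mS fS lS]] := fr (3 * r); first by apply/andP; split; lra.
  exists (r, S); split => // _; split => //=.
  by rewrite r_gt0 r1.
pose r y := (rS y).1; pose S y := (rS y).2.
have mS y : measurable (S y) by case: (rSP y).
have rZ y : Z y -> 0 < r y <= 1 by case: (rSP y) => _ /[apply] -[].
move: cZ; rewrite compact_cover => cZ.
have [|y Zy|D' D'Z ZD'] := cZ 'rV[R]_n Z (fun y => ball y (r y)).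
- by move=> y _; exact: ball_open.
- by exists y => //; apply: ballxx; case/andP: (rZ y Zy).
pose s := [seq (y, r y) | y <- finmap.enum_fset D'].
have sZ b : b \in s -> Z b.1 /\ b.2 = r b.1.
  by move=> /mapP[y /D'Z/set_mem Zy ->].
have [|b /sZ[Zb ->]|D [Ds Dcov Dsum]] :=
  @vitali_selection R n s (ball 0 (M + 1)).
- exact: measurable_rV_ball.
- have /andP[r0 r1] := rZ _ Zb; split => // v bv.
  exact: ball_triangle (ZM _ Zb) (le_ball r1 bv).
exists (\big[setU/set0]_(d <- D) S d.1); split.
- exact: bigsetU_measurable.
- move=> _ [z Zz <-]; have [y D'y yz] := ZD' z Zz.
  have [|d dD /(_ z yz) dz] := Dcov (y, r y); first exact: map_f.
  have [Zd d2] := sZ _ (Ds _ dD).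
  rewrite -bigcup_seq; exists d => //.
  have [_ /(_ Zd)[_ + _]] := rSP d.1; apply; exists z => //.
  by rewrite -/(r d.1) -d2.
- apply: le_trans (measure_big_setU_le _ _ _) _ => //.
  apply: (@le_trans _ _
    (\sum_(d <- D) (eta * 3 ^+ n)%:E * lebesgue_rV (ball d.1 d.2))%E).
    rewrite !big_seq; apply: lee_sum => d /Ds/sZ[Zd d2].
    have [_ /(_ Zd)[/andP[rd _] _ +]] := rSP d.1; move=> /le_trans; apply.
    rewrite lebesgue_rV_ball; last by rewrite d2.
    rewrite -EFinM lee_fin d2 -/(r d.1).
    by rewrite !exprMn -[leRHS]mulrA (mulrCA (3 ^+ n)).
  rewrite -ge0_sume_distrr; last by move=> *; exact: measure_ge0.
  have : ((eta * 3 ^+ n)%:E * (\sum_(d <- D) lebesgue_rV (ball d.1 d.2)) <=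
      (eta * 3 ^+ n)%:E * lebesgue_rV (ball (0%R : 'rV[R]_n) (M + 1)))%E.
    by rewrite lee_pmul2l// lte_fin mulr_gt0// exprn_gt0.
  move=> /le_trans; apply.
  rewrite lebesgue_rV_ball ?addr_gt0// -EFinM lee_fin -/C -mulrA.
  by rewrite divfK// gt_eqF// mulr_gt0// exprn_gt0.
Qed.
End sard.

(** * Closed sets and their projections *)

Section measurability.
Context {R : realType}.

Lemma rV_rational_dense n (x : 'rV[R]_n) (e : R) : 0 < e ->
  exists q : 'rV[rat]_n, ball (map_mx ratr q : 'rV[R]_n) e x.
Proof.
move=> e0.
have /choice[q qP] : forall j, exists q : rat,
    ratr q \in `]x 0 j - e, x 0 j + e[.
  by move=> j; apply: rat_in_itvoo; rewrite ltrD2l gtrN.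
exists (\row_j q j); rewrite rV_ball_box// => j; rewrite !mxE.
by apply: ball_sym; rewrite ball_itv; exact: qP.
Qed.

(** An open set is the union of the countably many products of balls with
    rational centres and radii 1/(k+1) that it contains, and balls of the sup norm
    are boxes. *)
Lemma open_prod_rV_measurable p q (U : set ('rV[R]_p * 'rV[R]_q)) :
  open U -> measurable U.
Proof.
move=> oU.
pose B (t : 'rV[rat]_p * 'rV[rat]_q * nat) : set ('rV[R]_p * 'rV[R]_q) :=
  ball (map_mx ratr t.1.1 : 'rV[R]_p) t.2.+1%:R^-1 `*`
  ball (map_mx ratr t.1.2 : 'rV[R]_q) t.2.+1%:R^-1.
have mB t : measurable (B t).
  by apply: measurableX; exact: measurable_rV_ball.
rewrite (_ : U = \bigcup_t (if `[< B t `<=` U >] then B t else set0)).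
  apply: countable_bigcupT_measurable; first exact: countableP.
  by move=> t; case: ifPn.
apply/seteqP; split=> [[x y] Uxy|z [t _]]; last by case: asboolP => // BU /BU.
have [e/= e0 eU] : nbhs_ball (x, y) U by apply/nbhs_ballP; exact: oU.
(* 2 / (k + 1) <= e, so a ball of radius 1 / (k + 1) that contains (x, y) is
   included in the ball of radius e around (x, y). *)
pose k := Num.truncn (2 / e).
have k0 : 0 < k.+1%:R^-1 :> R by rewrite invr_gt0.
have ke : k.+1%:R^-1 + k.+1%:R^-1 <= e.
  rewrite -mulr2n -[_ *+ 2]mulr_natl -ler_pdivlMl// mulrC -[leRHS]invrK.
  rewrite lef_pV2 ?posrE ?invr_gt0 ?divr_gt0// invf_div ltW//.
  exact: truncnS_gt.
have [a ax] := rV_rational_dense x k0; have [b by_] := rV_rational_dense y k0.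
exists (a, b, k) => //; case: asboolP => //; case=> -[x' y'] [/= ax' by'].
by apply: eU; split => /=; apply: le_ball ke _ _; apply: ball_triangle; eauto;
  exact: ball_sym.
Qed.

Lemma closed_prod_rV_measurable p q (C : set ('rV[R]_p * 'rV[R]_q)) :
  closed C -> measurable C.
Proof.
move=> cC; rewrite -[C]setCK; apply: measurableC; apply: open_prod_rV_measurable.
exact: closed_openC.
Qed.

End measurability.

(** Near a point t outside the projection, the open complement of C contains
    neighbourhoods of all (t, u) with u in K; compactness of K makes them
    uniform. *)
Lemma closed_compact_projection (T U : topologicalType) (C : set (T * U))
    (K : set U) :
  closed C -> compact K -> closed [set t | exists2 u, K u & C (t, u)].
Proof.
move=> cC /compact_near_coveringP cK.
rewrite -[mkset _]setCK; apply: open_closedC.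
rewrite openE => t tC.
have near_notC u : K u -> \forall u' \near u & t' \near nbhs t, ~ C (t', u').
  move=> Ku; have : nbhs (t, u) (~` C).
    apply: open_nbhs_nbhs; split; first exact: closed_openC.
    by move=> Ctu; apply: tC; exists u.
  move=> [[A B] [/= At Bu] AB]; exists (B, A) => // -[u' t'] [/= Bu' At'].
  by apply: (AB (t', u')); split.
have := cK _ _ (fun t' u => ~ C (t', u)) (nbhs_filter t) near_notC.
by apply: filterS => t' h [u Ku]; exact: h.
Qed.

(** * Continuity of pairings and determinants *)

Lemma continuous_pairing (T U V : topologicalType) (f : T -> U) (g : T -> V) :
  continuous f -> continuous g -> continuous (fun t => (f t, g t)).
Proof.
move=> cf cg t; apply: (@cvg_pair _ _ _ _ (nbhs (f t)) (nbhs (g t))).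
  exact: cf.
exact: cg.
Qed.

Lemma continuous_det {R : realType} (T : topologicalType) m (A : T -> 'M[R]_m) :
  (forall i j, continuous (fun t => A t i j)) -> continuous (fun t => \det (A t)).
Proof.
move=> cA; apply: continuous_big => [|s _]; first exact: add_continuous.
move=> t; apply: cvgM; first exact: cvg_cst.
apply: cvg_big => [|i _]; [exact: mul_continuous|exact: cA].
Qed.

(** * Derivatives of slices, rows and linear forms *)

Section partial_derivatives.
Context {R : realType}.

(** Moving by h (0, e) leaves the first coordinate fixed, so both difference
    quotients are the same function of h. *)
Lemma derive_slice (V W : normedModType R) (f : V * W -> R) x y e :
  'D_e (fun w => f (x, w)) y = 'D_(0, e) f (x, y).
Proof.
suff fE : (fun w => f (x, w)) \o shift y \o ( *:%R ^~ e) =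
    f \o shift (x, y) \o ( *:%R ^~ ((0, e) : V * W)).
  by rewrite /derive (funext (fun h => congr1 (fun t => h^-1 *: (t - f (x, y)))
    (congr1 (@^~ h) fE))).
apply/funext => h.
rewrite /comp; congr f.
by rewrite /shift /=; congr pair; rewrite /= scaler0 add0r.
Qed.

Lemma differentiable_slice (V W : normedModType R) (f : V * W -> R) x y :
  differentiable f (x, y) -> differentiable (fun w => f (x, w)) y.
Proof.
by move=> df; apply: (@differentiable_comp _ _ _ _ (fun w => (x, w)) f).
Qed.

Lemma differentiable_row n (V : normedModType R) (F : 'I_n -> V -> R) x :
  (forall i, differentiable (F i) x) ->
  differentiable (fun v => \row_i F i v : 'rV[R]_n) x.
Proof.
move=> dF.
rewrite (_ : (fun v => _) =
  \sum_i (fun v => F i v *: (delta_mx 0 i : 'rV[R]_n))).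
  by apply: differentiable_sum => i; exact: differentiableZl.
apply/funext => v; rewrite fct_sumE.
by rewrite [LHS]row_sum_delta; apply: eq_bigr => i _; rewrite mxE.
Qed.

Lemma jacobian_row n (F : 'I_n -> 'rV[R]_n -> R) y :
  (forall i, differentiable (F i) y) ->
  jacobian (fun v => \row_i F i v : 'rV[R]_n) y =
  \matrix_(i, j) 'D_(basis_rV i) (F j) y.
Proof.
move=> dF; have dr := differentiable_row dF.
apply/matrixP => i j; rewrite mxE.
have := deriveEjacobian (delta_mx 0 i) dr.
rewrite -rowE derive_mx; last exact: diff_derivable.
move/rowP => /(_ j); rewrite !mxE => <-.
by rewrite (_ : (fun t => _) = F j)//; apply/funext => v; rewrite mxE.
Qed.

Lemma is_derive_linear_form m (a : 'rV[R]_m) i y :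
  is_derive y (basis_rV i) (fun y : 'rV[R]_m => \sum_j a 0 j * y 0 j) (a 0 i).
Proof.
suff qa : (fun h => h^-1 *: (((fun y : 'rV[R]_m => \sum_j a 0 j * y 0 j) \o
    shift y) (h *: basis_rV i) - \sum_j a 0 j * y 0 j)) @ 0^' --> (a 0 i : R).
  by apply: DeriveDef; [apply/cvg_ex; exists (a 0 i)|exact: cvg_lim qa].
apply: cvg_near_cst; near=> h.
rewrite /= -sumrB (bigD1 i)//= big1 ?addr0 => [|j ji].
  rewrite !mxE !eqxx/= mulr1 mulrDr addrK.
  rewrite /GRing.scale/= mulrCA mulVf ?mulr1//.
  by near: h; exact: nbhs_dnbhs_neq.
by rewrite !mxE (negbTE ji) andbF mulr0 add0r subrr.
Unshelve. all: by end_near.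
Qed.

End partial_derivatives.

(** * Tilting by a linear form *)

Section tilt.
Context {R : realType} {n m : nat}.
Variable g : 'rV[R]_n -> 'rV[R]_m -> R.

Let G (z : 'rV[R]_n * 'rV[R]_m) := g z.1 z.2.

Definition partial_y j := 'D_(0, basis_rV j) G.

Definition partial_yy (z : 'rV[R]_n * 'rV[R]_m) : 'M[R]_m :=
  \matrix_(i, j) 'D_(0, basis_rV i) (partial_y j) z.

Hypothesis smooth_g : class_C 2 G.

Let tilt (a : 'rV[R]_m) x y := g x y + \sum_(i < m) a 0 i * y 0 i.

Let dG z : differentiable G z. Proof. by case: smooth_g => + _; exact. Qed.

Lemma differentiable_partial_y j z : differentiable (partial_y j) z.
Proof. by case: smooth_g => _ /(_ (0, basis_rV j))[+ _]; exact. Qed.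

Lemma continuous_partial_yy i j : continuous (fun z => partial_yy z i j).
Proof.
rewrite (_ : (fun z => _) = 'D_(0, basis_rV i) (partial_y j)).
  by case: smooth_g => _ /(_ (0, basis_rV j))[_ /(_ (0, basis_rV i))].
by apply/funext => z; rewrite mxE.
Qed.

Lemma derive_tilt a x j y :
  'D_(basis_rV j) (tilt a x) y = partial_y j (x, y) + a 0 j.
Proof.
rewrite /tilt (_ : (fun y => _) =
  (fun y => G (x, y)) + (fun y : 'rV[R]_m => \sum_(i < m) a 0 i * y 0 i))//.
have da := is_derive_linear_form a j y.
rewrite deriveD ?derive_slice ?(@derive_val _ _ _ _ _ _ _ da)//.
by apply: diff_derivable; exact: (differentiable_slice (dG _)).
Qed.

Lemma gradient_tilt a x y : gradient (tilt a x) y = \row_j partial_y j (x, y) + a.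
Proof. by apply/rowP => j; rewrite !mxE derive_tilt. Qed.

Lemma hessian_tilt a x y : hessian (tilt a x) y = partial_yy (x, y).
Proof.
apply/matrixP => i j; rewrite !mxE.
rewrite (_ : 'D_(basis_rV j) _ = (fun y => partial_y j (x, y)) + cst (a 0 j)).
  rewrite deriveD ?derive_cst ?addr0 ?derive_slice//.
  by apply/diff_derivable/differentiable_slice; exact: differentiable_partial_y.
by apply/funext => w; rewrite derive_tilt.
Qed.

(** The pairs (a, x) for which K contains a degenerate stationary point, by
    [gradient_tilt] and [hessian_tilt]; in this form a enters only additively. *)
Definition degenerate_in (K : set 'rV[R]_m) : set ('rV[R]_m * 'rV[R]_n) :=
  [set p : 'rV[R]_m * 'rV[R]_n | exists2 y, K y &
    (forall j, partial_y j (p.2, y) + p.1 0 j = 0) /\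
    \det (partial_yy (p.2, y)) = 0].

Lemma closed_degenerate_in K : compact K -> closed (degenerate_in K).
Proof.
move=> cK.
pose C : set (('rV[R]_m * 'rV[R]_n) * 'rV[R]_m) :=
  (\bigcap_j [set z : ('rV[R]_m * 'rV[R]_n) * 'rV[R]_m |
    partial_y j (z.1.2, z.2) + z.1.1 0 j = 0]) `&`
  [set z | \det (partial_yy (z.1.2, z.2)) = 0].
have cxy : continuous
    (fun z : ('rV[R]_m * 'rV[R]_n) * 'rV[R]_m => (z.1.2, z.2)).
  apply: continuous_pairing => z; last exact: cvg_snd.
  by apply: continuous_comp; [exact: cvg_fst|exact: cvg_snd].
have cC : closed C.
  apply: closedI.
    apply: closed_bigI => j _.
    apply: (@preimage_closed _ _ _ [set x : R | x = 0]); last exact: closed_eq.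
    move=> z _; apply: cvgD.
      apply: (@continuous_comp _ _ _
        (fun z : ('rV[R]_m * 'rV[R]_n) * 'rV[R]_m => (z.1.2, z.2))
        (partial_y j)); first exact: cxy.
      exact/differentiable_continuous/differentiable_partial_y.
    apply: (@continuous_comp _ _ _
      (fun z : ('rV[R]_m * 'rV[R]_n) * 'rV[R]_m => z.1.1)
      (fun a : 'rV[R]_m => a 0 j)); last exact: coord_continuous.
    by apply: continuous_comp; exact: cvg_fst.
  apply: (@preimage_closed _ _ _ [set x : R | x = 0]); last exact: closed_eq.
  move=> z _; apply: (@continuous_comp _ _ _
    (fun z : ('rV[R]_m * 'rV[R]_n) * 'rV[R]_m => (z.1.2, z.2))
    (fun w => \det (partial_yy w))); first exact: cxy.
  by apply: continuous_det => i j; exact: continuous_partial_yy.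
rewrite (_ : degenerate_in K = [set p | exists2 y, K y & C (p, y)]).
  exact: closed_compact_projection cC cK.
apply/seteqP; split => [p [y Ky [C1 C2]]|p [y Ky [C1 C2]]]; exists y => //.
  by split => // j _; exact: C1.
by split => // j; exact: C1.
Qed.

(** The bad a are the critical values, on K, of y |-> - grad_y g(x, y), whose
    Jacobian matrix is the opposite of the Hessian. *)
Lemma negligible_degenerate_in K x : compact K ->
  (@lebesgue_rV R m).-negligible [set a | degenerate_in K (a, x)].
Proof.
move=> cK.
pose f y : 'rV[R]_m := \row_j - partial_y j (x, y).
pose Z := K `&` [set y | \det (partial_yy (x, y)) = 0].
have df y j : differentiable (fun y => - partial_y j (x, y)) y.
  apply: differentiableN; apply: differentiable_slice.
  exact: differentiable_partial_y.
have cZ : compact Z.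
  apply: compact_closedI => //.
  apply: (@preimage_closed _ _ _ [set x : R | x = 0]); last exact: closed_eq.
  move=> y _; apply: continuous_det => i j {}y.
  apply: (@continuous_comp _ _ _ (fun y => (x, y)) (fun z => partial_yy z i j)).
    apply: (@continuous_pairing _ _ _ (cst x) id); last first.
      by move=> t; exact: cvg_id.
    exact: cst_continuous.
  exact: continuous_partial_yy.
have : (@lebesgue_rV R m).-negligible (f @` Z).
  apply: sard_compact => // y [_ detH]; split; first exact: differentiable_row.
  rewrite jacobian_row// (_ : \matrix_(_, _) _ = - 1 *: partial_yy (x, y)).
    by rewrite detZ detH mulr0.
  apply/matrixP => i j; rewrite !mxE deriveN ?derive_slice ?mulN1r//.
  apply: diff_derivable; apply: differentiable_slice.
  exact: differentiable_partial_y.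
apply: negligibleS => a [y Ky [/= aE detH]]; exists y; first by split.
by apply/rowP => j; have /eqP := aE j; rewrite addrC addr_eq0 mxE => /eqP ->.
Qed.

Lemma ae_tilt_morse : {ae @lebesgue_rV R m, forall a : 'rV[R]_m,
  {ae @lebesgue_rV R n, forall x, morse (tilt a x)}}.
Proof.
pose K k : set 'rV[R]_m := [set y | forall i, `[- k%:R, k%:R]%classic (y 0 i)].
have cK (k : nat) : compact (K k).
  have := @rV_compact R m (fun=> `[- k%:R, k%:R]%classic); apply => _.
  exact: segment_compact.
pose B := \bigcup_k degenerate_in (K k).
have mB : measurable B.
  apply: bigcup_measurable => k _; apply: closed_prod_rV_measurable.
  exact: closed_degenerate_in.
have B0 x : lebesgue_rV (ysection B x) = 0%E.
  apply: measure_negligible; first exact: measurable_ysection.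
  rewrite (_ : ysection B x = \bigcup_k [set a | degenerate_in (K k) (a, x)]).
    by apply: negligible_bigcup => k; exact: negligible_degenerate_in.
  by apply/seteqP; split => a; rewrite /ysection/= inE.
have := product_null_ae (@lebesgue_rV R n) mB B0.
apply: filterS => a Ba; exists (xsection B a); split => //.
  exact: measurable_xsection.
move=> x /= notmorse; rewrite /xsection/= inE; apply: contrapT => notB.
apply: notmorse => y; rewrite gradient_tilt hessian_tilt => grad0.
apply/eqP => det0; apply: notB.
pose k := (Num.truncn `|y|).+1.
exists k => //; exists y => /=.
  move=> i; rewrite /= in_itv/= -ler_norml (le_trans (ler_coord_norm _ _))//.
  by apply: ltW; exact: truncnS_gt.
by split => // j; move/rowP : grad0 => /(_ j); rewrite !mxE.
Qed.
End tilt.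

(** The uniform law on the cube is a multiple of a restriction of the Lebesgue
    measure, so it is absolutely continuous. *)
Lemma ae_uniform_cube {R : realType} m (nu : R) (P : 'rV[R]_m -> Prop) : 0 < nu ->
  {ae lebesgue_rV, forall a, P a} -> {ae uniform_cube m nu, forall a, P a}.
Proof.
move=> nu0 [N [mN N0 PN]]; exists N; split => //.
rewrite uniform_cubeE// (_ : lebesgue_rV _ = 0%E) ?mul0e//.
apply/eqP; rewrite eq_le measure_ge0 andbT -N0; apply: le_measure; rewrite ?inE//.
by apply: measurableI => //; exact: measurable_cube.
Qed.

Theorem theorem2p1 (R : realType) (n m : nat) (X : set 'rV[R]_n)
    (g : 'rV[R]_n -> 'rV[R]_m -> R)
    (smooth_g : smooth (fun z : 'rV[R]_n * 'rV[R]_m => g z.1 z.2))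
    (nu : R) (nu_gt0 : 0 < nu) :
  {ae uniform_cube m nu, forall a : 'rV[R]_m,
    {ae lebesgue_rV, forall x : 'rV[R]_n,
      X x -> morse (fun y => g x y + \sum_(i < m) a 0 i * y 0 i)}}.
Proof.
apply: ae_uniform_cube => //.
apply: filterS (ae_tilt_morse (smooth_g 2%N)) => a.
by apply: filterS => x + _.
Qed.
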